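(* Let $C_1(n)$ be the number of payphone permutations of type (C1) and size $n$. Then for any integer $n\geq 1$, $$C_1(n) = n\cdot G(S(n-1)),$$ where the function $G$ is defined on the finite multisets $M$ of positive integers by $$G(M) := \bigg(\prod_{k\geq 1} (\#_{2k} M + \#_{2k-1} M)!\bigg) \cdot 2^{\sum_{k\geq 2} \#_{2k} M}.$$
   Context: Multisets: $\#_k M$ denotes the multiplicity of $k$ in the multiset $M$, and $\cup$ denotes union of multisets with multiplicities added. For $n\ge 0$, the finite multiset $S(n)$ of positive integers is defined recursively by $S(0)=\emptyset$ and $$S(n)=\{n\}\cup S\left(\left\lfloor\tfrac{n-1}{2}\right\rfloor\right)\cup S\left(\left\lceil\tfrac{n-1}{2}\right\rceil\right)\quad (n\ge 1).$$ Type (C1) payphone permutations: $n$ payphones, labeled $1,\dots,n$, are arranged in a circle. Persons $1,2,\dots,n$ come one after another and each occupies an available payphone. The first person takes any payphone. Each subsequent person takes any available payphone such that its closest occupied payphone is as distant as possible, where distance is measured along the circle (i.e., among all available payphones, the person picks one maximizing the distance to the set of occupied payphones). The resulting assignment of people to payphones, $(p_1,\dots,p_n)$ with $p_j$ the person occupying payphone $j$, is a payphone permutation of type (C1) and size $n$; $C_1(n)$ counts the distinct permutations of $\{1,\dots,n\}$ that can arise this way. *)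

(* Defs.v *)
From mathcomp Require Import all_boot all_fingroup.
From mathcomp Require Import finmap multiset zify.

Set Implicit Arguments.
Unset Strict Implicit.
Unset Printing Implicit Defensive.

Local Open Scope mset_scope.
Local Open Scope nat_scope.

(* [fuel] only bounds the recursion depth; [fuel = n] is always enough, and
   [SmsetS] below is the intended recursion, where
   m./2 = floor (m / 2) and uphalf m = ceil (m / 2). *)
Fixpoint Smset_rec (fuel n : nat) : {mset nat} :=
  match fuel, n with
  | f.+1, m.+1 => [mset m.+1] `+` Smset_rec f m./2 `+` Smset_rec f (uphalf m)
  | _, _ => mset0
  end.

Definition Smset (n : nat) : {mset nat} := Smset_rec n n.

Lemma Smset_rec_fuel f n : n <= f -> Smset_rec f n = Smset n.
Proof.
rewrite /Smset; elim: f {-2}f (leqnn f) n => [|b IHb] f lefb n lenf.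
  by have -> : f = n by lia.
case: f n lefb lenf => [|f] [|m] lefb lenf //=.
by rewrite !(IHb f) ?(IHb m) //; lia.
Qed.

Lemma Smset0 : Smset 0 = mset0.
Proof. by []. Qed.

Lemma SmsetS n : 1 <= n ->
  Smset n = [mset n] `+` Smset (n - 1)./2 `+` Smset (uphalf (n - 1)).
Proof.
case: n => [//|m] _; rewrite subn1 /= {1}/Smset /=.
by rewrite !Smset_rec_fuel //; lia.
Qed.

(* All elements of [M] are <= N, and 2k - 1 >= k for k >= 1, so every factor
   with k > N equals 0! and every summand with k > N equals 0. *)
Definition G (M : {mset nat}) : nat :=
  let N := \max_(x <- M) x in
  (\prod_(1 <= k < N.+1) (M (2 * k) + M (2 * k - 1))`!) *
  2 ^ (\sum_(2 <= k < N.+1) M (2 * k)).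

(* Payphones and persons 1, ..., n are represented by 0, ..., n-1 in 'I_n.
   The two arguments of [minn] are the lengths of the two arcs. *)
Definition circ_dist (n : nat) (i j : 'I_n) : nat :=
  minn ((i + (n - j)) %% n) ((j + (n - i)) %% n).

(* For nonempty [A] the default value [n] is irrelevant: [circ_dist] < n. *)
Definition dist_to_set (n : nat) (j : 'I_n) (A : {set 'I_n}) : nat :=
  \big[minn/n]_(a in A) circ_dist j a.

(* [p j] is the person occupying payphone [j]; these are the payphones
   occupied when person [i] arrives. *)
Definition occupied (n : nat) (p : {perm 'I_n}) (i : 'I_n) : {set 'I_n} :=
  [set j | p j < i].

(* The payphone [(p^-1)%g i] taken by person [i] is automatically available
   on arrival of [i], since [p] is a permutation. *)
Definition payphone_C1 (n : nat) (p : {perm 'I_n}) : bool :=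
  [forall i : 'I_n, (0 < i) ==>
    [forall j in ~: occupied p i,
      dist_to_set j (occupied p i)
        <= dist_to_set ((p^-1)%g i) (occupied p i)]].

Definition C1 (n : nat) : nat := #|[set p : {perm 'I_n} | payphone_C1 p]|.

(* Main.v *)
(* A gap is a maximal run of m free payphones between two occupied ones; the
   largest distance attained in it is ceil(m/2), at one or two places according
   to the parity of m. Occupying such a place replaces m by floor((m-1)/2) and
   ceil((m-1)/2), so it removes exactly one copy of m from the sum T of the
   multisets S(m) over all current gaps. By induction on the number of free
   payphones, the number of ways to complete an assignment is G(T): if K is the
   largest value of ceil(m/2) over the gaps and K > 1, all elements 2K and 2K-1
   of T are current gaps, and G(T) = sum over the optimal choices of G(T - {m}).
   For K = 1 a gap of length 2 leaves a gap of length 1 that is again optimal,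
   but then every free payphone is optimal. Once the first person has chosen,
   there is one gap, of length n - 1. *)
Require Import Defs.
From mathcomp Require Import all_boot.
From mathcomp Require Import all_fingroup.
From mathcomp Require Import zmodp finmap multiset zify.

Set Implicit Arguments.
Unset Strict Implicit.
Unset Printing Implicit Defensive.

Local Open Scope mset_scope.
Local Open Scope nat_scope.

(** * The function [G] in terms of multiplicities *)

(** An explicit range [B] gives all gap lists the same product, whatever their maxima. *)
Definition Gfun (B : nat) (c : nat -> nat) : nat :=
  (\prod_(1 <= k < B.+1) (c (2 * k) + c (2 * k - 1))`!) *
  2 ^ (\sum_(2 <= k < B.+1) c (2 * k)).

Lemma eq_Gfun B c c' : c =1 c' -> Gfun B c = Gfun B c'.
Proof.
move=> E; rewrite /Gfun; congr (_ * 2 ^ _); apply: eq_bigr => k _; by rewrite !E.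
Qed.

Lemma G_Gfun (M : {mset nat}) B : (forall x, x \in M -> x <= B) ->
  G M = Gfun B M.
Proof.
move=> MB; rewrite /G /Gfun; set N := \max_(x <- M) x.
have NB : N <= B by apply/bigmax_leqP_seq => x xM _; exact: MB.
have M0 x : N < x -> M x = 0.
  move=> Nx; apply/eqP; rewrite mset_eq0; apply: contraTN Nx => xM.
  by rewrite -leqNgt /N; apply: (leq_bigmax_seq (F := id)).
congr (_ * 2 ^ _).
  rewrite [RHS](@big_cat_nat _ _ _ N.+1) //=.
  rewrite [X in _ = _ * X]big1_seq ?muln1 // => k.
  by rewrite mem_index_iota => /= /andP[Nk _]; rewrite !M0 //; lia.
(* For [N = 0] the range from 2 cannot be split at [N.+1 = 1]. *)
have [N0|N0] := posnP N.
  rewrite N0 big_geq // big1_seq // => k; rewrite mem_index_iota => /= /andP[k2 _].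
  by rewrite M0 //; lia.
rewrite [RHS](@big_cat_nat _ _ _ N.+1) //=.
rewrite [X in _ = _ + X]big1_seq ?addn0 // => k.
by rewrite mem_index_iota => /= /andP[Nk _]; rewrite !M0 //; lia.
Qed.

(** One more copy of [m] enlarges only the factorial at index [uphalf m]; it doubles the power of 2
    only for even [m > 2], since that sum starts at index 2. *)
Lemma Gfun_add1 B c m : 0 < m -> uphalf m <= B ->
  let K := uphalf m in
  Gfun B (fun x => (x == m) + c x) =
  (c (2 * K) + c (2 * K - 1)).+1 * (if K == 1 then 1 else (~~ odd m).+1) * Gfun B c.
Proof.
move=> m0 mB K; rewrite /Gfun.
have KB : K \in index_iota 1 B.+1 by rewrite mem_index_iota /K; lia.
rewrite !(big_rem K KB) /=.
have Krem k : k \in rem K (index_iota 1 B.+1) -> (1 <= k) /\ k <> K.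
  rewrite mem_rem_uniq ?iota_uniq // inE mem_index_iota.
  by move=> /andP[/eqP ? ?]; split => //; lia.
have -> : (2 * K == m) + c (2 * K) + ((2 * K - 1 == m) + c (2 * K - 1)) =
          (c (2 * K) + c (2 * K - 1)).+1 by rewrite /K; lia.
rewrite factS.
have -> : \prod_(k <- rem K (index_iota 1 B.+1))
     ((2 * k == m) + c (2 * k) + ((2 * k - 1 == m) + c (2 * k - 1)))`! =
   \prod_(k <- rem K (index_iota 1 B.+1)) (c (2 * k) + c (2 * k - 1))`!.
  rewrite [LHS]big_seq [RHS]big_seq; apply: eq_bigr => k /Krem[k1 kK].
  have -> : (2 * k == m) = false by apply/negbTE; rewrite /K in kK *; lia.
  by have -> : (2 * k - 1 == m) = false by apply/negbTE; rewrite /K in kK *; lia.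
rewrite big_split expnD /=.
have -> : 2 ^ (\sum_(2 <= k < B.+1) (2 * k == m)) =
   if K == 1 then 1 else (~~ odd m).+1.
  case: (eqVneq K 1) => K1.
    rewrite big_nat_cond big1 // => k; rewrite andbT => ?.
    by apply/eqP; rewrite eqb0; rewrite /K in K1 *; lia.
  have KB2 : K \in index_iota 2 B.+1 by rewrite mem_index_iota /K in K1 *; lia.
  rewrite (big_rem K KB2) big_seq big1 /=.
    have -> : (2 * K == m) = ~~ odd m by rewrite /K; lia.
    by case: (odd m).
  move=> k; rewrite mem_rem_uniq ?iota_uniq // inE mem_index_iota.
  by move=> /andP[/eqP ? ?]; apply/eqP; rewrite eqb0 /K; rewrite /K in K1 *; lia.
rewrite -!mulnA; congr (_ * _); lia.
Qed.

(** * Multiplicities in [Smset] and optimal places in one gap *)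

Lemma SmsetSE m x : 0 < m ->
  Smset m x = (x == m) + Smset (m - 1)./2 x + Smset (uphalf (m - 1)) x.
Proof. by move=> m0; rewrite SmsetS // !msetE2 msetnE; case: (x == m). Qed.

Lemma Smset_gt m x : m < x -> Smset m x = 0.
Proof.
elim/ltn_ind: m => m IH mx; case: (posnP m) => [->|m0]; first by rewrite mset0E.
by rewrite SmsetSE // !IH; lia.
Qed.

(** For [uphalf m = K > 1], both halves of [m - 1] are below [2K - 1], so only [m] itself counts.
    For [K = 1], S(1) = {1} and S(2) = {1, 2} have [m] elements. *)
Lemma Smset_top m K : 0 < K -> uphalf m <= K ->
  Smset m (2 * K) + Smset m (2 * K - 1) =
  if uphalf m == K then (if K == 1 then m else 1) else 0.
Proof.
move=> K0 mK; case: eqP => [mKe|mKn]; last by rewrite !Smset_gt //; lia.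
case: eqP => [K1|K1].
  have S1 x : Smset 1 x = (x == 1).
    by rewrite SmsetSE // !Smset0 !mset0E !addn0.
  have S2 x : Smset 2 x = (x == 2) + (x == 1).
    by rewrite SmsetSE // Smset0 mset0E S1 addn0.
  have [->|->] : m = 1 \/ m = 2 by lia.
    by rewrite K1 !S1.
  by rewrite K1 !S2.
rewrite !(@SmsetSE m) ?(@Smset_gt _./2) ?(@Smset_gt (uphalf _)); lia.
Qed.

(** When [uphalf m = K], the places are [K] and [m.+1 - K], which coincide exactly for odd [m]. *)
Lemma count_mid m K : 0 < K -> uphalf m <= K ->
  count (fun t => minn t (m.+1 - t) == K) (iota 1 m) =
  if uphalf m == K then (~~ odd m).+1 else 0.
Proof.
move=> K0 mK; case: eqP => [mKe|mKn].
  rewrite (@eq_in_count _ _ (predU (pred1 K) (pred1 (m.+1 - K)))); last first.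
    by move=> t; rewrite mem_iota /=; lia.
  case: (boolP (odd m)) => om.
    rewrite (@eq_count _ _ (pred1 K)) ?count_uniq_mem ?iota_uniq //; last first.
      by move=> t /=; lia.
    by rewrite mem_iota; lia.
  have := count_predUI (pred1 K) (pred1 (m.+1 - K)) (iota 1 m).
  rewrite !count_uniq_mem ?iota_uniq // !mem_iota.
  rewrite (@eq_count _ (predI _ _) pred0) ?count_pred0; last by move=> t /=; lia.
  by lia.
by apply/eqP; rewrite -leqn0 leqNgt -has_count; apply/hasPn => t; rewrite mem_iota; lia.
Qed.

(** * Summation over the optimal choices *)

Definition gap_count (L : seq (nat * nat)) (x : nat) : nat :=
  \sum_(g <- L) Smset g.2 x.

(** An optimal [t] cuts [m - 1] into its two halves, in either order, as in the recursion for
    [Smset]. *)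
Lemma gap_count_split L b m t K : (b, m) \in L -> 0 < t <= m -> uphalf m = K ->
  minn t (m.+1 - t) = K ->
  gap_count L =1 (fun x => (x == m) +
    gap_count [:: (b, t - 1), (b + t, m - t) & rem (b, m) L] x).
Proof.
move=> gL tm mK tK x; rewrite /gap_count (big_rem _ gL) /= !big_cons /=.
rewrite SmsetSE; last by lia.
have [[-> ->]|[-> ->]] : (t - 1 = (m-1)./2 /\ m - t = uphalf (m-1)) \/
   (t - 1 = uphalf (m-1) /\ m - t = (m-1)./2) by lia.
  by rewrite !addnA.
by rewrite -!addnA; congr (_ + _); rewrite addnCA.
Qed.

(* The inner sum is over the optimal choices in the gap g = (b, m). There are
   [(~~ odd m).+1] of them, and by [Gfun_add1] each term is the right-hand side
   divided by the number of elements 2K and 2K - 1 of the gap count and, if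
   1 < K, by [(~~ odd m).+1]. For K = 1, m itself is [(~~ odd m).+1]. *)
Lemma sum_Gfun B K L : 0 < K <= B ->
  (forall g, g \in L -> uphalf g.2 <= K) ->
  (exists2 g, g \in L & uphalf g.2 = K) ->
  \sum_(g <- L) \sum_(t <- iota 1 g.2 | minn t (g.2.+1 - t) == K)
    Gfun B (gap_count [:: (g.1, t - 1), (g.1 + t, g.2 - t) & rem g L]) =
  Gfun B (gap_count L).
Proof.
move=> /andP[K0 KB] LK [g0 g0L g0K].
pose c := gap_count L; pose cK := c (2 * K) + c (2 * K - 1).
have cKE : cK = \sum_(g <- L) if uphalf g.2 == K then (if K == 1 then g.2 else 1) else 0.
  rewrite /cK /c /gap_count -big_split /= big_seq [RHS]big_seq.
  by apply: eq_bigr => g gL; rewrite Smset_top //; exact: LK.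
have g00 : 0 < g0.2 by case: (g0.2) g0K => // /esym K00; rewrite K00 in K0.
have cK0 : 0 < cK.
  by rewrite cKE (big_rem _ g0L) /= g0K eqxx addn_gt0; case: eqP; rewrite ?g00.
(* Multiplying by [cK] avoids division; expanding it on the right by [cKE] gives each gap its own
   share, so the identity is checked gap by gap. *)
apply/eqP; rewrite -(eqn_pmul2l cK0); apply/eqP.
rewrite {2}cKE big_distrl big_distrr /= big_seq [RHS]big_seq.
apply: eq_bigr => -[b m] gL /=; have := LK _ gL => /= mK.
have E t : 0 < t <= m -> minn t (m.+1 - t) == K ->
   Gfun B c = cK * (if K == 1 then 1 else (~~ odd m).+1) *
     Gfun B (gap_count [:: (b, t - 1), (b + t, m - t) & rem (b, m) L]).
  move=> tm /eqP tK; have mKe : uphalf m = K by lia.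
  have cE := gap_count_split gL tm mKe tK.
  rewrite (eq_Gfun _ cE) Gfun_add1; [|lia..].
  by congr (_ * _ * _); rewrite ?mKe // /cK /c !cE; lia.
pose s := if K == 1 then 1 else (~~ odd m).+1.
have s0 : 0 < s by rewrite /s; case: ifP.
apply/eqP; rewrite -(eqn_pmul2l s0) mulnA big_distrr /=; apply/eqP.
rewrite big_seq_cond (eq_bigr (fun=> Gfun B c)); last first.
  by move=> t /andP[]; rewrite mem_iota => tm tK; rewrite (E t) // (mulnC s).
rewrite -big_seq_cond big_const_seq iter_addn_0 count_mid // mulnA mulnC.
by rewrite /s; congr (_ * _); case: eqP => // mKe; case: eqP => // K1; lia.
Qed.

(** * Distances along the circle *)

Section Circle.
Variable p : nat.
Local Notation n := p.+1.
Implicit Types (A : {set 'I_n}) (i j : 'I_n) (L : seq (nat * nat)).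

Lemma inZp_arc i j : inZp (i + (j + (n - i)) %% n) = j.
Proof.
apply: val_inj; rewrite /= modnDmr.
have -> : i + (j + (n - i)) = j + n by have := ltn_ord i; lia.
by rewrite modnDr modn_small.
Qed.

Lemma inZp_inj_add x y d : inZp (x + d) = inZp (y + d) :> 'I_n ->
  inZp x = inZp y :> 'I_n.
Proof.
by move=> /(congr1 val) /= /eqP; rewrite eqn_modDr => /eqP xy; apply: val_inj.
Qed.

Lemma inZp_modDl x d : inZp (x %% n + d) = inZp (x + d) :> 'I_n.
Proof. by apply: val_inj; rewrite /= modnDml. Qed.

Lemma circ_distC i j : circ_dist i j = circ_dist j i.
Proof. by rewrite /circ_dist minnC. Qed.

Lemma circ_dist_le x d : circ_dist (inZp x : 'I_n) (inZp (x + d)) <= d.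
Proof.
rewrite geq_min; apply/orP; right; rewrite /=.
rewrite modnDml.
have -> : x + d + (n - x %% n) = (x %/ n).+1 * n + d.
  by have := divn_eq x n; have := ltn_pmod x (ltn0Sn p); lia.
by rewrite modnMDl leq_mod.
Qed.

Lemma circ_distP i j :
  j = inZp (i + circ_dist i j) \/ i = inZp (j + circ_dist i j).
Proof.
by rewrite /circ_dist /minn; case: ifP => _; [right|left]; rewrite inZp_arc.
Qed.

Lemma dist_to_set_le j A a : a \in A -> dist_to_set j A <= circ_dist j a.
Proof.
rewrite /dist_to_set => aA; have := mem_index_enum a.
elim: (index_enum _) => //= x r IH; rewrite inE big_cons => /orP[/eqP<-|/IH ar].
  by rewrite aA geq_minl.
by case: ifP => // _; rewrite geq_min ar orbT.
Qed.

Lemma dist_to_set_ge j A d : d <= n ->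
  (forall a, a \in A -> d <= circ_dist j a) -> d <= dist_to_set j A.
Proof.
move=> dn dA; rewrite /dist_to_set.
apply: (big_ind (fun x => d <= x)) => // x y dx dy.
by rewrite leq_min dx.
Qed.

(** * Gaps between occupied payphones *)

(* The gap (b, m) consists of the m payphones following the payphone b. *)
Definition gap_seq (g : nat * nat) : seq 'I_n :=
  [seq inZp (g.1 + t) | t <- iota 1 g.2].

(** The two ends bound the distance from above. An occupied payphone nearer than both would lie
    inside the gap, in one of the two directions. *)
Lemma dist_gap A b m t : m < n ->
  inZp b \in A -> inZp (b + m.+1) \in A ->
  (forall j, j \in gap_seq (b, m) -> j \notin A) -> 0 < t <= m ->
  dist_to_set (inZp (b + t)) A = minn t (m.+1 - t).
Proof.
move=> mn bA bmA gA tm; apply/eqP; rewrite eqn_leq; apply/andP; split.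
  rewrite leq_min; apply/andP; split.
    apply: leq_trans (dist_to_set_le _ bA) _.
    by rewrite circ_distC circ_dist_le.
  apply: leq_trans (dist_to_set_le _ bmA) _.
  have -> : b + m.+1 = b + t + (m.+1 - t) by lia.
  exact: circ_dist_le.
apply: dist_to_set_ge; first by lia.
move=> a aA; have := circ_distP (inZp (b + t)) a.
set d := circ_dist _ _ => -[E|E]; rewrite leqNgt; apply/negP => dlt.
  apply: (negP (gA a _) aA); apply/mapP; exists (t + d); first by rewrite mem_iota /=; lia.
  by rewrite E /= inZp_modDl addnA.
apply: (negP (gA a _) aA); apply/mapP; exists (t - d); first by rewrite mem_iota /=; lia.
rewrite -[LHS]valZpK; apply: (@inZp_inj_add _ _ d); rewrite -E.
by congr inZp; rewrite /=; lia.
Qed.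

(** As [enum] has no repetitions, the gaps are disjoint and cover the free payphones. Empty gaps are
    allowed. *)
Definition gaps_of A L : Prop :=
  (forall g, g \in L -> inZp g.1 \in A /\ inZp (g.1 + g.2.+1) \in A) /\
  perm_eq (flatten [seq gap_seq g | g <- L]) (enum (~: A)).

Lemma gap_seq_split b m t : 0 < t <= m ->
  gap_seq (b, m) = gap_seq (b, t - 1) ++ inZp (b + t) :: gap_seq (b + t, m - t).
Proof.
move=> tm; rewrite /gap_seq /=.
have {1}-> : m = (t - 1) + (m - t).+1 by lia.
rewrite iotaD map_cat subnKC; last by lia.
congr (_ ++ _); rewrite /= -(addn1 t) iotaDl -map_comp; congr cons.
by apply: eq_map => x /=; rewrite addnA.
Qed.

Lemma gaps_of_add A L b m t : gaps_of A L -> (b, m) \in L -> 0 < t <= m ->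
  gaps_of (inZp (b + t) |: A) [:: (b, t - 1), (b + t, m - t) & rem (b, m) L].
Proof.
move=> [LA Lp] gL tm; have [bA bmA] := LA _ gL; split.
  move=> g; rewrite !inE => /or3P[/eqP->|/eqP->|/mem_rem/LA[-> ->]]; last by rewrite !orbT.
    rewrite /= in bA bmA *; rewrite bA orbT; split => //.
    suff -> : (t - 1).+1 = t by rewrite eqxx.
    by lia.
  rewrite /= in bA bmA *; rewrite eqxx; split => //.
  suff -> : b + t + (m - t).+1 = b + m.+1 by rewrite bmA orbT.
  by lia.
have pL : perm_eq (flatten [seq gap_seq g | g <- L])
    (gap_seq (b, m) ++ flatten [seq gap_seq g | g <- rem (b, m) L]).
  by have /(perm_map gap_seq)/perm_flatten := perm_to_rem gL.
have jA : inZp (b + t) \notin A.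
  have : inZp (b + t) \in enum (~: A).
    rewrite -(perm_mem Lp) (perm_mem pL) mem_cat (gap_seq_split b tm).
    by rewrite mem_cat inE eqxx orbT.
  by rewrite mem_enum inE.
(* Putting the new payphone back on both sides reduces the claim to the old free set, whose gap
   splits around it. *)
rewrite -(perm_cons (inZp (b + t))).
have pA : perm_eq (enum (~: A)) (inZp (b + t) :: enum (~: (inZp (b + t) |: A))).
  apply: uniq_perm; rewrite /= ?enum_uniq // ?mem_enum ?inE ?eqxx //.
  move=> x; rewrite inE !mem_enum !inE; case: eqP => //= ->; exact: jA.
rewrite perm_sym -(permPl pA) -(permPl Lp) (permPl pL) (gap_seq_split b tm) /=.
by rewrite -catA -[_ :: gap_seq _]cat1s -catA perm_catCA.
Qed.

Lemma gap_len_lt A L g : gaps_of A L -> g \in L -> g.2 < n.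
Proof.
move=> [LA Lp] gL; have [aA _] := LA _ gL.
have := perm_size Lp; rewrite -cardE.
have /(perm_map (@gap_seq))/perm_flatten/perm_size -> := perm_to_rem gL.
rewrite /= size_cat size_map size_iota => E.
have : #|~: A| < n.
  rewrite -[X in _ < X](card_ord n) -cardsT; apply: proper_card.
  rewrite properE subsetT; apply/subsetPn; exists (inZp g.1) => //.
  by rewrite inE negbK.
by rewrite -E; apply: leq_ltn_trans; exact: leq_addr.
Qed.

Definition farthest A j : bool :=
  [forall j' in ~: A, dist_to_set j' A <= dist_to_set j A].

(** The best distance within a gap is attained at its middle and equals half its length rounded up,
    so [K] is the largest over all free payphones. *)
Lemma farthest_gap A L b m t K : gaps_of A L -> (b, m) \in L -> 0 < t <= m ->
  (forall g, g \in L -> uphalf g.2 <= K) ->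
  (exists2 g, g \in L & uphalf g.2 = K) ->
  farthest A (inZp (b + t)) = (minn t (m.+1 - t) == K).
Proof.
move=> LA gL tm LK [[b0 m0] g0L /= g0K].
have [bndA pA] := LA.
have dist b1 m1 t1 : (b1, m1) \in L -> 0 < t1 <= m1 ->
    dist_to_set (inZp (b1 + t1)) A = minn t1 (m1.+1 - t1).
  move=> g1L t1m; have [? ?] := bndA _ g1L.
  apply: dist_gap => //; first exact: (gap_len_lt LA g1L).
  move=> j jg; have : j \in enum (~: A).
    by rewrite -(perm_mem pA); apply/flatten_mapP; exists (b1, m1).
  by rewrite mem_enum inE.
have mK := LK _ gL; rewrite /= in mK.
apply/forall_inP/eqP => [far|tK j].
  have t0m : 0 < uphalf m0 <= m0 by lia.
  have := far (inZp (b0 + uphalf m0)); rewrite !(dist _ _ _ _ t0m) //.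
  rewrite (dist _ _ _ gL tm) inE => /(_ _).
  suff jA : inZp (b0 + uphalf m0) \notin A by move=> /(_ jA); lia.
  have : inZp (b0 + uphalf m0) \in enum (~: A).
    rewrite -(perm_mem pA); apply/flatten_mapP; exists (b0, m0) => //.
    by apply/mapP; exists (uphalf m0); rewrite ?mem_iota //=; lia.
  by rewrite mem_enum inE.
rewrite -mem_enum -(perm_mem pA) => /flatten_mapP[[b1 m1] g1L /mapP[t1]].
rewrite mem_iota /= => t1m ->; have := LK _ g1L => /= m1K.
by rewrite (dist _ _ _ gL tm) (dist _ _ _ g1L); lia.
Qed.

(** * Counting the completions of a partial assignment *)

(* [q i] is the payphone taken by person [i]. *)
Definition taken (q : {perm 'I_n}) (i : nat) : {set 'I_n} :=
  q @: [set k : 'I_n | k < i].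

(** A partial assignment of the first [i] persons is stored as a total permutation [r], read only
    below [i]. *)
Definition completions (i : nat) (r : {perm 'I_n}) : {set {perm 'I_n}} :=
  [set q : {perm 'I_n} | [forall k : 'I_n,
     if k < i then q k == r k else farthest (taken q k) (q k)]].

Lemma eq_taken (q r : {perm 'I_n}) i :
  (forall k : 'I_n, k < i -> q k = r k) -> taken q i = taken r i.
Proof. by move=> qr; apply: eq_in_imset => k; rewrite inE; exact: qr. Qed.

Lemma notin_taken (q : {perm 'I_n}) (i : 'I_n) : q i \notin taken q i.
Proof.
by apply/imsetP => -[k]; rewrite inE => ki /perm_inj ik; rewrite ik ltnn in ki.
Qed.

Section Step.
Variables (r : {perm 'I_n}) (i j : 'I_n).
Hypothesis jr : j \notin taken r i.
(** The transposition sends person [i] to [j]; earlier persons keep their payphones, as neither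
    [r i] nor [j] is one of theirs. *)
Let r' := (r * tperm (r i) j)%g.

Lemma tperm_agree (k : 'I_n) : k < i -> r' k = r k.
Proof.
move=> ki; rewrite permM tpermD //.
  by apply: contraTneq ki => /perm_inj->; rewrite ltnn.
by apply: contraNneq jr => ->; rewrite imset_f // inE.
Qed.

Lemma tperm_next : r' i = j.
Proof. by rewrite permM tpermL. Qed.

Lemma taken_next : taken r' i.+1 = j |: taken r i.
Proof.
rewrite -(eq_taken tperm_agree) -tperm_next /taken.
suff -> : [set k : 'I_n | k < i.+1] = i |: [set k : 'I_n | k < i].
  exact: imsetU1.
by apply/setP => k; rewrite !inE ltnS leq_eqVlt.
Qed.

Lemma completions_next : farthest (taken r i) j ->
  [set q in completions i r | q i == j] = completions i.+1 r'.
Proof.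
move=> far; apply/setP => q; rewrite !inE; apply/andP/forallP.
  move=> [/forallP qr /eqP qi] k; rewrite ltnS leq_eqVlt.
  case: eqVneq => [/val_inj->|ki] /=; first by rewrite tperm_next qi.
  by have := qr k; case: ifP => // ki'; rewrite tperm_agree.
move=> qr; have qi : q i = j.
  by have := qr i; rewrite ltnSn tperm_next => /eqP.
split; last by rewrite qi.
have qk (k : 'I_n) : k < i -> q k = r k.
  by move=> ki; have := qr k; rewrite ltnS ltnW // tperm_agree // => /eqP.
apply/forallP => k; case: ltnP => [/qk->//|ik].
have [<-|ki] := eqVneq i k; first by rewrite qi (eq_taken qk).
by have := qr k; rewrite ltnS leqNgt ltn_neqAle ik ki.
Qed.

End Step.

Lemma card_completions_next r (i : 'I_n) :
  #|completions i r| =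
  \sum_(j in ~: taken r i | farthest (taken r i) j)
    #|completions i.+1 (r * tperm (r i) j)%g|.
Proof.
rewrite -sum1_card (partition_big (fun q : {perm 'I_n} => q i)
  (fun j => (j \in ~: taken r i) && farthest (taken r i) j)) /=.
  apply: eq_bigr => j; rewrite inE => /andP[jr far].
  by rewrite -completions_next // -sum1_card; apply: eq_bigl => q; rewrite !inE.
move=> q; rewrite !inE => /forallP qr.
have qk (k : 'I_n) : k < i -> q k = r k.
  by move=> ki; have := qr k; rewrite ki => /eqP.
by have := qr i; rewrite ltnn -(eq_taken qk) notin_taken.
Qed.

(** Induction on the number [f] of persons still to come. *)
Lemma card_completions f (i : nat) r L : i + f = n -> gaps_of (taken r i) L ->
  #|completions i r| = Gfun n (gap_count L).
Proof.
elim: f i r L => [|f IH] i r L.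
  (* With no payphone free, every gap is empty and [r] is the only completion. *)
  rewrite addn0 => -> [_ Lp].
  have L0 g : g \in L -> g.2 = 0.
    move=> gL; apply/eqP; rewrite -leqn0 leqNgt; apply/negP => g0.
    have : (inZp (g.1 + 1) : 'I_n) \in enum (~: taken r n).
      rewrite -(perm_mem Lp); apply/flatten_mapP; exists g => //.
      by apply/mapP; exists 1; rewrite ?mem_iota //; lia.
    rewrite mem_enum inE => /negP[]; rewrite -[X in X \in _](permKV r).
    by rewrite imset_f // inE.
  have -> : Gfun n (gap_count L) = 1.
    have c0 x : gap_count L x = 0.
      by rewrite /gap_count big_seq big1 // => g /L0->; rewrite Smset0 mset0E.
    by rewrite /Gfun !big1 // => k _; rewrite !c0.
  apply/eqP/cards1P; exists r; apply/setP => q; rewrite !inE.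
  apply/forallP/eqP => [qr|-> k]; last by rewrite ltn_ord.
  by apply/permP => k; have := qr k; rewrite ltn_ord => /eqP.
move=> ifn LA; have i_lt : i < n by lia.
pose i0 := Ordinal i_lt; rewrite -[i]/(nat_of_ord i0) in LA *.
rewrite card_completions_next.
have [LbA Lp] := LA.
pose K := \max_(g <- L) uphalf g.2.
have LK g : g \in L -> uphalf g.2 <= K.
  by move=> gL; apply: (leq_bigmax_seq (F := fun g => uphalf g.2)).
have [g0 g0L g00] : exists2 g, g \in L & 0 < g.2.
  have : r i0 \in enum (~: taken r i0) by rewrite mem_enum inE notin_taken.
  rewrite -(perm_mem Lp) => /flatten_mapP[g gL /mapP[t]]; rewrite mem_iota => tm _.
  by exists g => //; move: tm; case: (g.2) => //; lia.
have K0 : 0 < K by apply: leq_trans (LK _ g0L); rewrite uphalf_gt0.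
have exK : exists2 g, g \in L & uphalf g.2 = K.
  case: (boolP (has (fun g => uphalf g.2 == K) L)) =>
    [/hasP[g gL /eqP]|/hasPn LnK].
    by exists g.
  have : K <= K.-1.
    apply/bigmax_leqP_seq => g gL _.
    by have := LK _ gL; rewrite leq_eqVlt (negbTE (LnK _ gL)); case: (K).
  by rewrite -ltnS prednK // ltnn.
have Kn : 0 < K <= n.
  rewrite K0 /=.
  by have [g gL <-] := exK; have := gap_len_lt LA gL; lia.
(* The sum over free payphones becomes a double sum over gaps and positions, matching [sum_Gfun]. *)
rewrite -(sum_Gfun Kn LK exK) big_mkcondr -big_enum -(perm_big _ Lp) /=.
rewrite big_flatten big_map big_seq [RHS]big_seq; apply: eq_bigr => -[b m] gL.
rewrite big_map [RHS]big_mkcond big_seq [RHS]big_seq; apply: eq_bigr => t.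
rewrite mem_iota add1n ltnS /= => tm.
rewrite (farthest_gap LA gL tm LK exK); case: ifP => // _.
apply: IH; first by rewrite addSnnS.
rewrite taken_next; first exact: gaps_of_add.
have : (inZp (b + t) : 'I_n) \in enum (~: taken r i0).
  rewrite -(perm_mem Lp); apply/flatten_mapP; exists (b, m) => //.
  by apply/mapP; exists t; rewrite ?mem_iota.
by rewrite mem_enum inE.
Qed.

(** * The first person and the final count *)

(** The single gap starts and ends at [j], since [j + p.+1] is [j] modulo [n]. *)
Lemma gaps_of1 j : gaps_of [set j] [:: (nat_of_ord j, p)].
Proof.
split=> [g|].
  rewrite inE => /eqP-> /=; rewrite !inE; split; apply/eqP/val_inj => /=.
    by rewrite modn_small.
  by rewrite modnDr modn_small.
rewrite /= cats0; apply: uniq_perm; rewrite ?enum_uniq //.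
  rewrite map_inj_in_uniq ?iota_uniq // => x y; rewrite !mem_iota /= => xp yp.
  move/(congr1 val) => /= /eqP; rewrite eqn_modDl !modn_small; [by move/eqP|lia..].
move=> x; rewrite mem_enum !inE; apply/mapP/idP => [[t]|xj].
  rewrite mem_iota /= => tp ->; apply/eqP => /(congr1 val) /= /eqP.
  rewrite -{2}(modn_small (ltn_ord j)) -{2}[nat_of_ord j]addn0 eqn_modDl mod0n.
  by rewrite modn_small; lia.
exists ((x + (n - j)) %% n); last by rewrite inZp_arc.
rewrite mem_iota /= lt0n add1n ltn_mod andbT; apply: contra xj => /eqP x0.
by apply/eqP; rewrite -(inZp_arc j x) x0 addn0 valZpK.
Qed.

Lemma occupied_taken (q : {perm 'I_n}) i : occupied q^-1%g i = taken q i.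
Proof.
apply/setP => j; rewrite inE -[in LHS](permKV q j) permK -[in RHS](permKV q j).
by rewrite mem_imset ?inE //; exact: perm_inj.
Qed.

Lemma taken0 (q : {perm 'I_n}) : taken q 0 = set0.
Proof.
by rewrite -[RHS](imset0 q); congr (_ @: _); apply/setP => k; rewrite !inE. Qed.

Lemma farthest_set0 j : farthest set0 j.
Proof. by apply/forall_inP => k _; rewrite /dist_to_set !big_set0. Qed.

Lemma C1_completions : C1 n = #|completions 0 1%g|.
Proof.
rewrite /C1 -(card_imset _ (@invg_inj _)); apply: eq_card => q.
rewrite -{1}[q]invgK mem_imset; last exact: invg_inj.
rewrite !inE; apply: eq_forallb => k; rewrite /= occupied_taken invgK.
(* [payphone_C1] exempts person 0; with nothing occupied all distances equal the default [n], so
   [farthest] holds there too. *)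
by case: posnP => // ->; rewrite taken0 farthest_set0.
Qed.

Lemma C1_succ : C1 n = n * G (Smset p).
Proof.
rewrite C1_completions -[0]/(nat_of_ord (ord0 : 'I_n)) card_completions_next.
rewrite taken0 (eq_bigr (fun=> G (Smset p))) => [|j _].
  rewrite (eq_bigl predT) ?sum_nat_const ?card_ord // => j.
  by rewrite !inE farthest_set0.
rewrite (card_completions (f := p) (L := [:: (nat_of_ord j, p)])) //; last first.
  rewrite taken_next ?taken0 ?inE // setU0; exact: gaps_of1.
rewrite (@G_Gfun _ n) => [|x].
  by apply: eq_Gfun => x; rewrite /gap_count big_seq1.
by rewrite in_mset; case: (ltnP p x) => [/Smset_gt->//|/leqW].
Qed.

End Circle.

Theorem theorem3 (n : nat) (hn : 1 <= n) : C1 n = n * G (Smset (n - 1)).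
Proof. by case: n hn => // p _; rewrite C1_succ subn1. Qed.
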